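(* For all positive integers $n$ and $k$, $$r_2(n,k)=\sum_{i=2}^{n}\binom{n}{i}\,(k+n-i)!\;B_{i,k}(0,1,1,\ldots,1),$$ where $B_{i,k}$ are the partial Bell polynomials, evaluated with first argument equal to $0$ and all remaining arguments equal to $1$.
   Context: For positive integers $n$ and $k$, $r_2(n,k)$ denotes the number of ordered partitions of an $n$-element set (finite sequences of pairwise disjoint nonempty subsets, called blocks, whose union is the whole set) having exactly $k$ blocks of cardinality at least $2$ (the other blocks being singletons). Equivalently, it is the number of outcomes of a race among $n$ distinct participants with exactly $k$ ties of size at least $2$. The partial Bell polynomials are $$B_{i,k}(x_1,x_2,\ldots,x_{i-k+1})=\sum\frac{i!}{s_1!\,s_2!\cdots s_{i-k+1}!}\prod_{j=1}^{i-k+1}\left(\frac{x_j}{j!}\right)^{s_j},$$ where the sum is over all nonnegative integers $s_1,s_2,\ldots,s_{i-k+1}$ such that $s_1+s_2+\cdots+s_{i-k+1}=k$ and $s_1+2s_2+\cdots+(i-k+1)s_{i-k+1}=i$. When these conditions have no nonnegative integer solution (in particular when $i<k$), the value of $B_{i,k}$ is $0$. Empty sums are $0$. *)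

(* Defs.v *)
From HB Require Import structures.
From mathcomp Require Import all_boot all_order all_algebra.

Set Implicit Arguments.
Unset Strict Implicit.
Unset Printing Implicit Defensive.

Import Order.TTheory GRing.Theory Num.Theory.
Local Open Scope ring_scope.

Definition ordered_partition (T : finType) (s : seq {set T}) : bool :=
  [&& all (fun A : {set T} => A != set0) s,
      pairwise (fun A B : {set T} => [disjoint A & B]) s
    & \bigcup_(A <- s) A == [set: T]].

Definition big_blocks (T : finType) (s : seq {set T}) : nat :=
  count (fun A : {set T} => (2 <= #|A|)%N) s.

(* Justifies the range of the outer sum in [r2]. *)
Lemma size_ordered_partition (T : finType) (s : seq {set T}) :
  ordered_partition s -> (size s <= #|T|)%N.
Proof.
case/and3P=> s0 sD _.
suff: (size s <= #|\bigcup_(A <- s) A|)%N by move/leq_trans; apply; apply: max_card.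
elim: s s0 sD => [|A s IH] //= /andP[A0 s0] /andP[AD sD].
rewrite big_cons cardsU.
have -> : A :&: \bigcup_(B <- s) B = set0.
  rewrite big_distrr /= big_seq big1 // => B Bs; apply/eqP.
  by rewrite setI_eq0; exact: (allP AD).
by rewrite cards0 subn0 -add1n leq_add ?card_gt0 // IH.
Qed.

(* Ordered partitions of 'I_n are counted by their number m of blocks; m <= n
   because blocks are nonempty and disjoint. *)
Definition r2 (n k : nat) : nat :=
  (\sum_(m < n.+1)
     #|[set t : m.-tuple {set 'I_n} |
         ordered_partition t && (big_blocks t == k)]|)%N.

(* [partial_bell i k x] is B_{i,k}(x_1, ..., x_{i-k+1}), where x_j is [x j].
   The ordinal j stands for the index j+1, so [s j] is s_{j+1}; each s_j is
   at most k since they sum to k.  For i < k the truncated i - k leaves the one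
   variable s_1 with s_1 = k and s_1 = i, so the sum is empty. *)
Definition partial_bell (F : numFieldType) (i k : nat) (x : nat -> F) : F :=
  \sum_(s : {ffun 'I_(i - k).+1 -> 'I_k.+1} |
        (\sum_(j < (i - k).+1) s j == k)%N
        && (\sum_(j < (i - k).+1) j.+1 * s j == i)%N)
    (i`!)%:R / (\prod_(j < (i - k).+1) ((s j)`!)%:R)
      * \prod_(j < (i - k).+1) (x j.+1 / (j.+1`!)%:R) ^+ s j.

(* Main.v *)
Require Import Defs.
From HB Require Import structures.
From mathcomp Require Import all_boot all_order all_algebra.
From mathcomp Require Import ring.

(** The proof compares exponential generating functions, truncated to
polynomials.

Give a block of size j a weight w_j, and let W(X) be the sum of the
w_j X^j / j!.  Splitting off the first block shows that the total weight of
the sequences of m disjoint blocks covering a set of size n is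
n! [X^n] W(X)^m ([sum_tilings]).  For ordered partitions in which the blocks
of size at least 2 are marked by a variable y, the weights are 0, 1, y, y, ...,
so that W = X + y E with E = X^2/2! + X^3/3! + ..., and the binomial theorem
gives the number of those with m blocks, k of them of size at least 2, as
n! C(m, k) [X^(n - m + k)] E^k ([card_ordered_partition]).

On the other side, the multinomial theorem says that B_{i,k}(x) is
i!/k! [X^i] (x_1 X/1! + x_2 X^2/2! + ...)^k ([partial_bellE]); with arguments
0, 1, 1, ... the series is again E.  The number of elements in blocks of size
at least 2 is i = n - m + k, so summing over m amounts to summing over i, with
m = k + n - i, and n! C(k + n - i, k) = C(n, i) (k + n - i)! i!/k!.  Since E is
divisible by X^2, the terms with i < 2 k vanish, which accounts for the
different ranges of the two sums. *)

Set Implicit Arguments.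
Unset Strict Implicit.
Unset Printing Implicit Defensive.

Import Order.TTheory GRing.Theory Num.Theory.
Local Open Scope ring_scope.

(** * Truncated exponential generating functions *)

Definition egf (R : comUnitRingType) (N : nat) (w : nat -> R) : {poly R} :=
  \poly_(j < N) (w j / (j`!)%:R).

(** Coefficients are divided by factorials both in a field and in a polynomial
ring over it, where the marking variable lives; this is what the two have in
common. *)
Definition nat_units (R : comUnitRingType) : Prop :=
  forall n, n.+1%:R \is a @GRing.unit R.

Lemma fact_unit (R : comUnitRingType) n :
  nat_units R -> (n`!)%:R \is a @GRing.unit R.
Proof. by move=> Ru; case: n`! (fact_gt0 n). Qed.

Lemma nat_units_numField (F : numFieldType) : nat_units F.
Proof. by move=> n; rewrite unitfE pnatr_eq0. Qed.

Lemma nat_units_poly (F : numFieldType) : nat_units {poly F}.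
Proof. by move=> n; rewrite -polyC_natr rmorph_unit // nat_units_numField. Qed.

Lemma bin_fact_inv (R : comUnitRingType) (n j : nat) :
  nat_units R -> (j <= n)%N ->
  'C(n, j)%:R = (n`!)%:R / (j`!)%:R / ((n - j)`!)%:R :> R.
Proof.
move=> Ru lejn; rewrite -(bin_fact lejn) !natrM !mulrA.
by rewrite mulrAC mulrK ?fact_unit// mulrK ?fact_unit.
Qed.

Lemma coef_exp_eq (R : nzRingType) (N m : nat) (p q : {poly R}) :
  (forall i, (i < N)%N -> p`_i = q`_i) ->
  forall i, (i < N)%N -> (p ^+ m)`_i = (q ^+ m)`_i.
Proof.
move=> pq; elim: m => [|m IH] i ltiN; first by rewrite !expr0.
rewrite !exprS !coefM; apply: eq_bigr => j _.
by rewrite pq ?IH ?(leq_ltn_trans _ ltiN) ?leq_subr // -ltnS.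
Qed.

(** * The multinomial theorem and partial Bell polynomials *)

(** This is exp(a_1 X) ... exp(a_r X) = exp((a_1 + ... + a_r) X) in degrees
below the truncation order. *)
Lemma coef_prod_exp (R : comUnitRingType) (I : Type) (a : I -> R) (r : seq I)
    (N l : nat) :
  nat_units R -> (l < N)%N ->
  (\prod_(i <- r) egf N (GRing.exp (a i)))`_l =
  (\sum_(i <- r) a i) ^+ l / (l`!)%:R.
Proof.
move=> Ru; elim: r l => [|i r IH] l ltlN.
  rewrite !big_nil coef1; case: l ltlN => [|l] _; first by rewrite expr0 divr1.
  by rewrite expr0n mul0r.
rewrite !big_cons coefM addrC exprDn mulr_suml; apply: eq_bigr => j _.
have lejl : (j <= l)%N by rewrite -ltnS.
rewrite coef_poly (leq_ltn_trans lejl) // IH ?(leq_ltn_trans _ ltlN) ?leq_subr//.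
rewrite -(mulr_natr _ 'C(l, j)) bin_fact_inv //.
rewrite mulrACA [a i ^+ j * _]mulrC -[_ / (j`!)%:R / _]mulrA.
by rewrite [(l`!)%:R * _]mulrC !mulrA mulrK ?fact_unit.
Qed.

(** Expanding the product of the truncated exponentials gives one monomial for
each choice of exponents s; the theorem is the comparison of the coefficients
of X^k.  Truncating at degree k makes the exponents range over 'I_k.+1. *)
Lemma multinomial (R : comUnitRingType) (I : finType) (a : I -> R) (k : nat) :
  nat_units R ->
  (\sum_i a i) ^+ k / (k`!)%:R =
  \sum_(s : {ffun I -> 'I_k.+1} | (\sum_i s i == k)%N)
     \prod_i (a i ^+ s i / ((s i)`!)%:R).
Proof.
move=> Ru; rewrite -(@coef_prod_exp _ _ a _ k.+1) //.
under eq_bigr do rewrite /egf poly_def.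
rewrite bigA_distr_bigA coef_sum [RHS]big_mkcond /=; apply: eq_bigr => s _.
rewrite scaler_prod prodrXr coefZ coefXn eq_sym.
by case: eqP; rewrite ?mulr1 ?mulr0.
Qed.

Lemma divp_natE (F : numFieldType) (p : {poly F}) n : (0 < n)%N ->
  p / n%:R = n%:R^-1 *: p.
Proof.
case: n => // n _; rewrite -mul_polyC mulrC -polyC_natr.
by rewrite rmorphV ?nat_units_numField.
Qed.

(** Apply the multinomial theorem to the monomials x_j X^j / j!: the exponents
s contribute to X^i exactly when the sum of the j s_j is i.  The hypothesis
x_0 = 0 makes the series start at X, as the variables of B_{i,k} do at x_1. *)
Lemma partial_bellE (F : numFieldType) (i k N : nat) (x : nat -> F) :
  x 0%N = 0 -> (i < N)%N ->
  partial_bell i k x = (i`!)%:R / (k`!)%:R * (egf N x ^+ k)`_i.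
Proof.
move=> x0 ltiN.
pose c j := x j.+1 / (j.+1`!)%:R.
pose Q := \sum_(j < (i - k).+1) (c j *: 'X^(j.+1)) : {poly F}.
(* In a product of k multiples of X, the coefficient of X^i involves each factor
   in degree at most i - k + 1 only, whence the number of variables. *)
have -> : (egf N x ^+ k)`_i = (Q ^+ k)`_i.
  pose q n := \poly_(j < n) c j.
  have eX n : \sum_(j < n) (c j *: 'X^(j.+1)) = 'X * q n :> {poly F}.
    rewrite /q poly_def mulr_sumr; apply: eq_bigr => j _.
    by rewrite -scalerAr -exprS.
  have -> : egf N x = 'X * q N.-1.
    rewrite -eX; case: N ltiN => // N _.
    by rewrite /egf poly_def big_ord_recl x0 mul0r scale0r add0r.
  rewrite /Q eX !exprMn !coefXnM; case: ltnP => // leki.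
  case: (posnP k) => [->|k0]; first by rewrite !expr0.
  apply: (@coef_exp_eq _ (i - k).+1) => // j ltj.
  rewrite !coef_poly ltj ifT // -ltnS (ltn_predK ltiN).
  rewrite (leq_ltn_trans _ ltiN) // (leq_trans ltj) //.
  by rewrite -subSn // leq_subLR -add1n leq_add2r.
have -> : (i`!)%:R / (k`!)%:R * (Q ^+ k)`_i
    = (i`!)%:R * (Q ^+ k / (k`!)%:R : {poly F})`_i.
  by rewrite divp_natE ?fact_gt0 // coefZ mulrA.
rewrite multinomial ?coef_sum; last exact: nat_units_poly.
rewrite /partial_bell big_mkcondr mulr_sumr; apply: eq_bigr => s _.
under [in RHS]eq_bigr do
  rewrite exprZn -exprM divp_natE ?fact_gt0 // scalerA mulrC.
rewrite scaler_prod prodrXr coefZ coefXn eq_sym.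
case: eqP => _; rewrite ?mulr0 // mulr1.
by rewrite prodf_div mulrA [RHS]mulrAC.
Qed.

(** * Weighted sequences of disjoint sets *)

Lemma big_tuple_cons (R : Type) (idx : R) (op : Monoid.com_law idx)
    (T : finType) (m : nat) (F : m.+1.-tuple T -> R) :
  \big[op/idx]_t F t =
  \big[op/idx]_x \big[op/idx]_(t : m.-tuple T) F [tuple of x :: t].
Proof.
rewrite pair_big /=.
rewrite (reindex (fun p : T * m.-tuple T => [tuple of p.1 :: p.2])) //=.
exists (fun t => (thead t, [tuple of behead t])) => [[x t] _|t _].
  by congr (_, _) => //; apply: val_inj.
by rewrite [RHS]tuple_eta.
Qed.

(** Blocks may be empty here: emptiness is ruled out later by a zero weight,
and [sum_tilings] holds for every weight at 0. *)
Definition tiling (T : finType) (S : {set T}) (s : seq {set T}) : bool :=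
  pairwise (fun A B : {set T} => [disjoint A & B]) s
  && (\bigcup_(A <- s) A == S).

Lemma all_disjoint (T : finType) (A : {set T}) (s : seq {set T}) :
  all (fun B : {set T} => [disjoint A & B]) s =
  [disjoint A & \bigcup_(B <- s) B].
Proof.
elim: s => [|B s IH] /=; first by rewrite big_nil -setI_eq0 setI0 eqxx.
by rewrite big_cons IH -!setI_eq0 setIUr setU_eq0.
Qed.

Lemma tiling_cons (T : finType) (S A : {set T}) (s : seq {set T}) :
  tiling S (A :: s) = (A \subset S) && tiling (S :\: A) s.
Proof.
rewrite /tiling /= all_disjoint big_cons.
set U := \bigcup_(B <- s) B.
case: (pairwise _ s); rewrite /= ?andbF ?andbT //.
apply/andP/andP => [[dAU /eqP <-]|[sAS /eqP ->]].
  split; first exact: subsetUl.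
  by rewrite setDUl setDv set0U eq_sym; apply/eqP/setDidPl; rewrite disjoint_sym.
split; last by rewrite -{1}(setIidPr sAS) setID.
by rewrite -setI_eq0 setIDA setDIl setDv set0I.
Qed.

Lemma sum_subset_card (R : nzSemiRingType) (T : finType) (S : {set T})
    (F : nat -> R) :
  \sum_(A : {set T} | A \subset S) F #|A| =
  \sum_(j < #|S|.+1) F j *+ 'C(#|S|, j).
Proof.
rewrite (partition_big (fun A : {set T} => inord #|A| : 'I_#|S|.+1) predT) //=.
apply: eq_bigr => j _.
rewrite (eq_bigr (fun=> F j)) => [|A /andP[sAS /eqP <-]]; last first.
  by rewrite inordK // ltnS subset_leq_card.
rewrite sumr_const -cards_draws; congr (_ *+ _); apply: eq_card => A.
rewrite !inE; apply: andb_id2l => sAS.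
by rewrite -val_eqE /= inordK // ltnS subset_leq_card.
Qed.

(** By induction on m: choosing the first block A leaves a tiling of S minus A,
and there are C(#|S|, j) blocks of size j, which is the product rule for
exponential generating functions. *)
Lemma sum_tilings (R : comUnitRingType) (T : finType) (w : nat -> R)
    (N m : nat) (S : {set T}) :
  nat_units R -> (#|S| < N)%N ->
  \sum_(t : m.-tuple {set T} | tiling S t) \prod_(A <- t) w #|A| =
  (#|S|`!)%:R * (egf N w ^+ m)`_#|S|.
Proof.
move=> Ru; elim: m S => [|m IH] S ltSN.
  rewrite big_mkcond /= (big_pred1 [tuple]) => [|t]; last exact/esym/eqP/tuple0.
  rewrite /tiling /= !big_nil expr0 coef1 eq_sym cards_eq0.
  by case: eqP => [->|_]; rewrite ?mulr0 // cards0 mulr1.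
rewrite big_mkcond big_tuple_cons /=.
transitivity (\sum_(A : {set T} | A \subset S)
    w #|A| * ((#|S| - #|A|)`!%:R * (egf N w ^+ m)`_(#|S| - #|A|))).
  rewrite [RHS]big_mkcond; apply: eq_bigr => A _.
  under eq_bigr do rewrite tiling_cons big_cons.
  case: ifP => [sAS|_] /=; last by rewrite big1.
  rewrite -big_mkcond -mulr_sumr IH ?cardsDS //.
  by rewrite (leq_ltn_trans (leq_subr _ _)).
rewrite (sum_subset_card S
  (fun j => w j * ((#|S| - j)`!%:R * (egf N w ^+ m)`_(#|S| - j)))).
rewrite exprS coefM mulr_sumr; apply: eq_bigr => j _.
have lejS : (j <= #|S|)%N by rewrite -ltnS.
rewrite coef_poly (leq_ltn_trans lejS) //.
rewrite -(mulr_natr _ 'C(_, _)) bin_fact_inv //.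
rewrite [_`!%:R * _`_(_)]mulrC [w j * _]mulrA mulrC -!mulrA.
congr (_ * _); rewrite [RHS]mulrCA; congr (_ * _).
by rewrite mulrC !mulrA mulrK ?fact_unit.
Qed.

(** * Marking the blocks of size at least two *)

Definition tie (F : numFieldType) (j : nat) : F := (1 < j)%:R.

(** The indeterminate 'X of {poly F} is the variable y that marks a tie; the
generating functions below are polynomials in X with coefficients in F[y]. *)
Definition marked (F : numFieldType) (j : nat) : {poly F} :=
  if j is j'.+1 then (if j' is 0 then 1 else 'X) else 0.

Lemma prod_marked (F : numFieldType) (T : finType) (s : seq {set T}) :
  \prod_(A <- s) marked F #|A| =
  if all (fun A : {set T} => A != set0) s then 'X^(big_blocks s) else 0.
Proof.
elim: s => [|A s IH]; first by rewrite big_nil expr0.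
rewrite big_cons IH /big_blocks /= -cards_eq0.
case: #|A| => [|[|j]] /=; first by rewrite mul0r.
  by rewrite mul1r add0n.
by case: all; rewrite ?mulr0 // exprS.
Qed.

(** Here 'X is the variable X of the generating functions and 'X%:P is y. *)
Lemma egf_marked (F : numFieldType) N : (1 < N)%N ->
  egf N (marked F) = 'X + 'X%:P * map_poly polyC (egf N (tie F)).
Proof.
move=> lt1N; apply/polyP => j.
rewrite coefD coefX coefCM coef_map /= !coef_poly.
case: ltnP => [_|leNj]; last first.
  by rewrite polyC0 mulr0 addr0 gtn_eqF // (leq_trans lt1N).
rewrite divp_natE ?fact_gt0 // /tie.
case: j => [|[|j]] /=; rewrite ?mul0r ?polyC0 ?mulr0 ?addr0 ?scaler0 //.
  by rewrite invr1 scale1r.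
by rewrite add0r mul1r -mul_polyC mulrC.
Qed.

(** Only the term C(m, k) X^(m - k) (y E)^k of the binomial expansion of
(X + y E)^m contains y^k. *)
Lemma coef_egf_marked (F : numFieldType) N m n k : (1 < N)%N -> (m <= n)%N ->
  (egf N (marked F) ^+ m)`_n`_k =
  'C(m, k)%:R * (egf N (tie F) ^+ k)`_(n - (m - k)).
Proof.
move=> lt1N lemn; rewrite egf_marked // exprDn coef_sum coef_sum.
have coefl (l : 'I_m.+1) :
    ('X^(m - l) * ('X%:P * map_poly polyC (egf N (tie F))) ^+ l
       *+ 'C(m, l))`_n`_k =
    if l == k :> nat then 'C(m, k)%:R * (egf N (tie F) ^+ k)`_(n - (m - k))
    else 0.
  rewrite coefMn coefMn exprMn -rmorphXn coefXnM ltnNge.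
  rewrite (leq_trans (leq_subr _ _)) //= -rmorphXn coefCM coef_map coefMC.
  rewrite coefXn /= eq_sym.
  by case: eqP => [->|_]; rewrite ?mul0r ?mul0rn // mul1r mulr_natl.
under eq_bigr do rewrite coefl.
rewrite -big_mkcond /=; case: (ltnP m k) => [ltmk|lekm].
  by rewrite bin_small // mul0r big1 // => l; rewrite mul0r.
rewrite (big_pred1 (inord k)) // => l.
by rewrite /= -[RHS]val_eqE /= inordK.
Qed.

(** The left side is the coefficient of y^k in the sum of the marked weights of
all tilings of T, since a block of weight 0 discards the sequences that
contain an empty block. *)
Lemma card_ordered_partition (F : numFieldType) (T : finType) N m k :
  (m <= #|T| < N)%N -> (1 < N)%N ->
  #|[set t : m.-tuple {set T} | ordered_partition t && (big_blocks t == k)]|%:R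
  = (#|T|`!)%:R * ('C(m, k)%:R * (egf N (tie F) ^+ k)`_(#|T| - (m - k))).
Proof.
case/andP=> lemT ltTN lt1N; rewrite -coef_egf_marked //.
rewrite mulr_natl -coefMn -[in RHS]mulr_natl -[#|T|]cardsT -sum_tilings ?cardsT //.
  2: exact: nat_units_poly.
rewrite coef_sum -sum1_card natr_sum big_mkcond [RHS]big_mkcond /=.
apply: eq_bigr => t _; rewrite inE prod_marked /ordered_partition /tiling.
case: (all _ t) => /=; last by rewrite coef0 if_same.
rewrite coefXn [k == _]eq_sym.
by case: pairwise; case: (_ == setT); case: (_ == k).
Qed.

Lemma coef_egf_tie (F : numFieldType) N k i :
  (i < 2 * k)%N -> (egf N (tie F) ^+ k)`_i = 0.
Proof.
move=> lti.
have -> : egf N (tie F) = 'X^2 * drop_poly 2 (egf N (tie F)).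
  apply/polyP => j; rewrite coefXnM coef_drop_poly.
  case: j => [|[|j]] /=; rewrite ?subnK // !coef_poly /tie /= ?mul0r ?if_same //.
by rewrite exprMn -exprM coefXnM lti.
Qed.

(** * The formula for the number of races *)

Theorem theorem15 (n k : nat) (hn : (0 < n)%N) (hk : (0 < k)%N) :
  (r2 n k)%:R =
  \sum_(2 <= i < n.+1)
     'C(n, i)%:R * ((k + n - i)`!)%:R
       * partial_bell i k (fun j : nat => (if j == 1%N then 0 else 1) : rat)
  :> rat.
Proof.
pose e i := (egf n.+1 (tie rat) ^+ k)`_i.
have e0 i : (i < 2 * k)%N -> e i = 0 by exact: coef_egf_tie.
pose term i := (n`!)%:R * ('C(k + n - i, k)%:R * e i).
transitivity (\sum_(k <= i < n.+1) term i).
  pose races m := (n`!)%:R * ('C(m, k)%:R * e (n - (m - k))%N).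
  rewrite /r2 natr_sum (eq_bigr (fun m : 'I_n.+1 => races m)); last first.
    move=> m _; rewrite (@card_ordered_partition _ _ n.+1) ?card_ord ?ltnS //.
    by rewrite leqnn andbT -ltnS.
  rewrite -(big_mkord predT races).
  (* The reversal of k..n sends the number m of blocks to i = k + n - m. *)
  rewrite [RHS]big_nat_rev /=.
  rewrite [RHS](@big_nat_widenl _ _ _ _ 0) // [RHS]big_mkcond.
  apply: eq_big_nat => m /andP[_ ltm]; case: leqP => [lekm|ltmk] /=; last first.
    by rewrite /races bin_small ?mul0r ?mulr0.
  rewrite /races /term addnS subSS.
  have -> : (k + n - (k + n - m))%N = m.
    by rewrite subKn // (leq_trans _ (leq_addl _ _)).
  by rewrite subnBA // addnC.
transitivity (\sum_(0 <= i < n.+1) term i).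
  rewrite (@big_nat_widenl _ _ _ k 0) // big_mkcond; apply: eq_big_nat => i _.
  case: leqP => //= ltik; rewrite /term e0 ?mulr0 //.
  by rewrite (leq_trans ltik) // leq_pmull.
rewrite [RHS](@big_nat_widenl _ _ _ 2 0) // [RHS]big_mkcond.
apply: eq_big_nat => i /andP[_ lti].
case: leqP => [lti2|_] /=.
  by rewrite /term e0 ?mulr0 // (@leq_ltn_trans 1) // leq_pmulr.
(* The two arguments differ at index 0 only, and partial_bell starts at 1. *)
have -> : partial_bell i k (fun j : nat => (if j == 1%N then 0 else 1) : rat)
    = partial_bell i k (tie rat).
  apply: eq_bigr => s _; congr (_ * _); apply: eq_bigr => j _.
  by rewrite /tie; case: (nat_of_ord j).
rewrite (@partial_bellE _ _ _ n.+1) // -/(e i) /term.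
have lein : (i <= n)%N by rewrite -ltnS.
rewrite -addnBA // !bin_fact_inv ?leq_addr //; try exact: nat_units_numField.
rewrite addKn.
have u j : j`!%:R != 0 :> rat by rewrite pnatr_eq0 -lt0n fact_gt0.
by field; rewrite !u.
Qed.
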